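(* Let $S$ be a densely defined symmetric operator with equal defect numbers in a Hilbert space $\mathfrak{H}$ which commutes with a non-trivial fundamental symmetry $J$, and let $\{C_\alpha\}_{\alpha\in D}$ be the set of all $C$-symmetries of $S$. Let $(\mathcal{H},\Gamma_0,\Gamma_1)$ be a boundary triplet for $S^*$ such that the formulas $$\mathcal{C}_\alpha\Gamma_0 f=\Gamma_0C_\alpha f,\qquad \mathcal{C}_\alpha\Gamma_1 f=\Gamma_1C_\alpha f,\qquad \forall\alpha\in D,\ \forall f\in\mathcal{D}(S^* )$$ correctly define an operator family $\{\mathcal{C}_\alpha\}_{\alpha\in D}$ in $\mathcal{H}$, and denote by $\mathcal{J}$ the operator $\mathcal{C}_\alpha$ corresponding to $C_\alpha=J$, i.e. $\mathcal{J}\Gamma_j=\Gamma_jJ$, $j=0,1$. Then for all $\alpha\in D$ $$\mathcal{C}_\alpha^2=I,\qquad \mathcal{J}\mathcal{C}_\alpha>0,$$ and the operator $\mathcal{J}$ is a fundamental symmetry in the Hilbert space $\mathcal{H}$.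
   Context: $\mathfrak{H}$ is a Hilbert space with inner product $(\cdot,\cdot)$. A fundamental symmetry is a bounded operator $J$ with $J=J^*$, $J^2=I$; it is non-trivial if $J\neq\pm I$. Commuting with a bounded operator $C$ means $SC=CS$ (including equality of domains). For bounded $T$, $T>0$ means $T$ is self-adjoint and $(Tx,x)>0$ for all $x\neq0$. $\{C_\alpha\}_{\alpha\in D}$ denotes the set (indexed by a set $D$) of all bounded operators $C$ in $\mathfrak{H}$ with $C^2=I$, $JC>0$ and $SC=CS$. It contains $J$. Each such $C$ also commutes with $S^*$, so it maps $\mathcal{D}(S^* )$ into itself. A boundary triplet for $S^*$ is a triplet $(\mathcal{H},\Gamma_0,\Gamma_1)$, where $\mathcal{H}$ is a Hilbert space and $\Gamma_0,\Gamma_1:\mathcal{D}(S^* )\to\mathcal{H}$ are linear, such that $(S^*x,y)-(x,S^*y)=(\Gamma_1x,\Gamma_0y)_{\mathcal{H}}-(\Gamma_0x,\Gamma_1y)_{\mathcal{H}}$ for all $x,y\in\mathcal{D}(S^* )$ and $(\Gamma_0,\Gamma_1):\mathcal{D}(S^* )\to\mathcal{H}\oplus\mathcal{H}$ is surjective. ''Correctly define'' means that for each $\alpha$ there is a single well-defined operator $\mathcal{C}_\alpha$ in $\mathcal{H}$ satisfying both formulas. *)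

(* Defs.v *)
From HB Require Import structures.
From mathcomp Require Import all_boot all_order all_algebra.
From mathcomp Require Import all_classical all_reals all_analysis.
From mathcomp Require Export complex.

Set Implicit Arguments.
Unset Strict Implicit.
Unset Printing Implicit Defensive.

Import Order.TTheory GRing.Theory Num.Theory.
Import numFieldNormedType.Exports.

Local Open Scope classical_set_scope.
Local Open Scope ring_scope.

(* Complex Hilbert spaces.  The inner product is linear in its first argument
   and conjugate-linear in the second one, and completeness refers to the norm
   it induces. *)
HB.mixin Record isHilbert (R : realType) (H : Type)
    of CompleteNormedModule R[i] H := {
  inner : {dot H for @Num.conj R[i]} ;
  normr_inner : forall x : H, `|x| ^+ 2 = inner x x
}.

#[short(type="hilbertType")]
HB.structure Definition Hilbert (R : realType) :=
  { H of isHilbert R H & CompleteNormedModule R[i] H }.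

Notation "''[' x , y ]" := (inner x y)
  (format "''[' x ,  y ]") : ring_scope.

Section Operators.
Context {R : realType}.
Implicit Types H K : hilbertType R.

Definition linear_set H (A : set H) :=
  A 0 /\ forall (a : R[i]) (x y : H), A x -> A y -> A (a *: x + y).

Definition linear_on H K (A : set H) (f : H -> K) :=
  forall (a : R[i]) (x y : H), A x -> A y -> f (a *: x + y) = a *: f x + f y.

(* An operator in H with its domain; the values of opfun outside dom are
   irrelevant, hence operators are compared with op_eq and not with =. *)
Record pre_operator H := PreOperator { dom : set H ; opfun :> H -> H }.

Definition linear_operator H (T : pre_operator H) :=
  linear_set (dom T) /\ linear_on (dom T) T.

Definition op_eq H (T U : pre_operator H) :=
  dom T = dom U /\ forall x, dom T x -> T x = U x.

Definition total H (f : H -> H) : pre_operator H := PreOperator setT f.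

Definition op_comp H (T U : pre_operator H) : pre_operator H :=
  PreOperator [set x | dom U x /\ dom T (U x)] (T \o U).

(* The vector z below is unique as soon as dom T is dense, which is the only
   case in which the adjoint is meaningful. *)
Definition adjoint_graph H (T : pre_operator H) (y z : H) :=
  forall x, dom T x -> '[T x, y] = '[x, z].

Definition adjoint H (T : pre_operator H) : pre_operator H :=
  PreOperator [set y | exists z, adjoint_graph T y z]
              (fun y => xget 0 [set z | adjoint_graph T y z]).

Definition densely_defined H (T : pre_operator H) := dense (dom T).

Definition symmetric_operator H (T : pre_operator H) :=
  linear_operator T /\
  forall x y, dom T x -> dom T y -> '[T x, y] = '[x, T y].

Definition bounded_operator H (T : H -> H) :=
  linear T /\ exists M : R, forall x, `|T x| <= (M%:C)%C * `|x|.

Definition self_adjoint H (T : pre_operator H) := op_eq T (adjoint T).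

(* The order on R[i] makes 0 < z mean that z is real and positive. *)
Definition positive_operator H (T : H -> H) :=
  [/\ bounded_operator T, self_adjoint (total T)
    & forall x, x != 0 -> 0 < '[T x, x]].

Definition fundamental_symmetry H (J : H -> H) :=
  [/\ bounded_operator J, self_adjoint (total J) & forall x, J (J x) = x].

Definition nontrivial_symmetry H (J : H -> H) :=
  J <> id /\ J <> (fun x => - x).

Definition commutes_with H (S : pre_operator H) (C : H -> H) :=
  op_eq (op_comp S (total C)) (op_comp (total C) S).

Definition C_symmetry H (S : pre_operator H) (J C : H -> H) :=
  [/\ bounded_operator C, forall x, C (C x) = x,
      positive_operator (J \o C) & commutes_with S C].

Definition orthonormal_set H (B : set H) :=
  (forall e, B e -> '[e, e] = 1) /\
  (forall e f, B e -> B f -> e <> f -> '[e, f] = 0).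

Definition orthonormal_basis H (V B : set H) :=
  [/\ B `<=` V, orthonormal_set B
    & forall x, V x -> (forall e, B e -> '[x, e] = 0) -> x = 0].

(* Equality of Hilbert dimensions, possibly infinite or uncountable. *)
Definition equal_hilbert_dim H (V W : set H) :=
  exists B1 B2 : set H,
    [/\ orthonormal_basis V B1, orthonormal_basis W B2 & (B1 #= B2)%card].

(* ker (S^* - z I) *)
Definition defect_subspace H (S : pre_operator H) (z : R[i]) : set H :=
  [set x | dom (adjoint S) x /\ adjoint S x = z *: x].

Definition equal_defect_numbers H (S : pre_operator H) :=
  equal_hilbert_dim (defect_subspace S 'i) (defect_subspace S (- 'i)).

Definition boundary_triplet H K (S : pre_operator H) (G0 G1 : H -> K) :=
  [/\ linear_on (dom (adjoint S)) G0,
      linear_on (dom (adjoint S)) G1,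
      forall x y, dom (adjoint S) x -> dom (adjoint S) y ->
        '[adjoint S x, y] - '[x, adjoint S y]
          = '[G1 x, G0 y] - '[G0 x, G1 y]
    & forall a b : K, exists f, [/\ dom (adjoint S) f, G0 f = a & G1 f = b]].

(* Since G0 maps dom S^* onto K, at most one c : K -> K satisfies this. *)
Definition boundary_image H K (S : pre_operator H) (G0 G1 : H -> K)
    (C : H -> H) (c : K -> K) :=
  linear c /\
  forall f, dom (adjoint S) f -> c (G0 f) = G0 (C f) /\ c (G1 f) = G1 (C f).

End Operators.

(* Main.v *)
Require Import Defs.
From mathcomp Require Import all_boot all_order all_algebra.
From mathcomp Require Import all_classical all_reals all_analysis.
From mathcomp Require Import ring lra.

(* Since C = C_alpha commutes with S and C^* = J C J, both J and A = J C commute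
   with S^*; Green's identity makes the boundary images of J and A symmetric,
   and an everywhere defined symmetric operator is bounded and self-adjoint
   (Hellinger-Toeplitz).  Let a be the boundary image of A.  For m > 0 the
   operator A + m is onto H, and the preimage under it of a vector of dom S^*
   lies in dom S^*; hence a + m is onto the boundary space, i.e. a has no
   negative spectrum.  The bottom of the numerical range of a bounded
   self-adjoint operator belongs to its spectrum, so a >= 0, and a is injective
   because it is a product of involutions. *)

Set Implicit Arguments.
Unset Strict Implicit.
Unset Printing Implicit Defensive.

Import Order.TTheory GRing.Theory Num.Theory.
Import numFieldNormedType.Exports.

Local Open Scope classical_set_scope.
Local Open Scope ring_scope.

Section HilbertSpaces.
Context {R : realType}.
Implicit Types H K : hilbertType R.

(** * Real-valued inner product and norm *)

Local Notation "r %:C" := (real_complex R r).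

(** Inner products and norms take values in [R[i]], which is only partially ordered. Their real
    parts live in the ordered field [R], where estimates and infima are available. *)
Definition rinner H (x y : H) : R := complex.Re '[x, y].
Definition rnorm H (x : H) : R := complex.Re `|x|.

Lemma ReD (a b : R[i]) : complex.Re (a + b) = complex.Re a + complex.Re b.
Proof. by case: a b => [? ?] [? ?]. Qed.

Lemma ReB (a b : R[i]) : complex.Re (a - b) = complex.Re a - complex.Re b.
Proof. by case: a b => [? ?] [? ?]. Qed.

Lemma ReZ (r : R) (a : R[i]) : complex.Re (r%:C * a) = r * complex.Re a.
Proof. by case: a => x y /=; rewrite mul0r subr0. Qed.

Lemma conj_realC (r : R) : Num.conj r%:C = r%:C.
Proof. by apply/CrealP; apply/complex_realP; exists r. Qed.

Lemma innerC H (x y : H) : '[x, y] = Num.conj '[y, x].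
Proof. by rewrite hermC expr0 mul1r. Qed.

Lemma innerDl H (x y z : H) : '[x + y, z] = '[x, z] + '[y, z].
Proof. by rewrite linearDl. Qed.

Lemma innerDr H (x y z : H) : '[z, x + y] = '[z, x] + '[z, y].
Proof. by rewrite linearDr. Qed.

Lemma innerZl H (a : R[i]) (x z : H) : '[a *: x, z] = a * '[x, z].
Proof. by rewrite linearZl_LR. Qed.

Lemma innerZr H (a : R[i]) (x z : H) : '[z, a *: x] = Num.conj a * '[z, x].
Proof. by rewrite linearZr_LR. Qed.

Lemma rinnerC H (x y : H) : rinner x y = rinner y x.
Proof.
rewrite /rinner innerC; apply: complexI.
by rewrite !complexRe Re_conj.
Qed.

Lemma rinnerDl H (x y z : H) : rinner (x + y) z = rinner x z + rinner y z.
Proof. by rewrite /rinner innerDl ReD. Qed.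

Lemma rinnerZl H (r : R) (x z : H) : rinner (r%:C *: x) z = r * rinner x z.
Proof. by rewrite /rinner innerZl ReZ. Qed.

Lemma rinnerDr H (x y z : H) : rinner z (x + y) = rinner z x + rinner z y.
Proof. by rewrite rinnerC rinnerDl !(rinnerC _ z). Qed.

Lemma rinnerZr H (r : R) (x z : H) : rinner z (r%:C *: x) = r * rinner z x.
Proof. by rewrite rinnerC rinnerZl (rinnerC x). Qed.

Lemma rinnerNl H (x z : H) : rinner (- x) z = - rinner x z.
Proof. by rewrite -scaleN1r -(rmorphN1 (real_complex R)) rinnerZl mulN1r. Qed.

Lemma rinnerNr H (x z : H) : rinner z (- x) = - rinner z x.
Proof. by rewrite rinnerC rinnerNl (rinnerC x). Qed.

Definition rinnerE := (rinnerDl, rinnerDr, rinnerZl, rinnerZr, rinnerNl, rinnerNr).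

Lemma rnormK H (x : H) : (rnorm x)%:C = `|x|.
Proof. by rewrite /rnorm RRe_real// ger0_real. Qed.

Lemma rnorm_ge0 H (x : H) : 0 <= rnorm x.
Proof. by rewrite -ler0c rnormK. Qed.

Lemma rnormD H (x y : H) : rnorm (x + y) <= rnorm x + rnorm y.
Proof. by rewrite -lecR rmorphD/= !rnormK ler_normD. Qed.

Lemma rnormN H (x : H) : rnorm (- x) = rnorm x.
Proof. by rewrite /rnorm normrN. Qed.

Lemma rnormB H (x y : H) : rnorm (x - y) = rnorm (y - x).
Proof. by rewrite /rnorm distrC. Qed.

Lemma rnormZ H (r : R) (x : H) : rnorm (r%:C *: x) = `|r| * rnorm x.
Proof.
apply: complexI; rewrite rmorphM/= !rnormK normrZ.
by congr (_ * _); rewrite normc_def/= expr0n addr0 sqrtr_sqr.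
Qed.

Lemma rnorm_eq0 H (x : H) : rnorm x = 0 -> x = 0.
Proof. by move=> x0; apply/normr0_eq0; rewrite -rnormK x0. Qed.

Lemma rnorm0 H : rnorm (0 : H) = 0.
Proof. by rewrite /rnorm normr0. Qed.

Lemma rinner_rnorm H (x : H) : rinner x x = rnorm x ^+ 2.
Proof.
apply: complexI.
by rewrite rmorphXn/= rnormK normr_inner RRe_real// ger0_real.
Qed.

(** Cauchy-Schwarz comes from the triangle inequality, which the normed space already provides:
    square [rnorm (z + y) <= rnorm z + rnorm y] and expand, then take [z = x] and [z = - x]. *)
Lemma rinner_le H (x y : H) : `|rinner x y| <= rnorm x * rnorm y.
Proof.
have key z : rinner z y <= rnorm z * rnorm y.
  have := rnormD z y; rewrite -(ler_pXn2r (ltn0Sn 1)) ?nnegrE ?addr_ge0 ?rnorm_ge0//.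
  rewrite -rinner_rnorm !rinnerE (rinnerC y z) !rinner_rnorm; nra.
by rewrite ler_norml lerNl -rinnerNl key -(rnormN x) key.
Qed.

(** * Completeness with explicit rates of convergence *)

Lemma expr_lt_eventually (q e : R) : 0 <= q < 1 -> 0 < e ->
  exists N, forall n, (N <= n)%N -> q ^+ n < e.
Proof.
move=> /andP[q0 q1] e0.
have qn : `|q| < 1 by rewrite ger0_norm.
have /cvgrPdist_lt/(_ e e0) [N _ NP] := cvg_expr qn.
exists N => n Nn; have := NP n Nn; rewrite /= sub0r normrN.
by rewrite ger0_norm ?exprn_ge0.
Qed.

(** The bound [e n] survives in the limit because [l - u n] splits at [u (maxn N n)], a term close
    to [l] and at distance at most [e n] from [u n]. *)
Lemma rnorm_cauchy_cvg H (u : nat -> H) (e : nat -> R) :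
  (forall d, 0 < d -> exists N, forall n, (N <= n)%N -> e n < d) ->
  (forall n m, (n <= m)%N -> rnorm (u m - u n) <= e n) ->
  exists l, forall n, rnorm (l - u n) <= e n.
Proof.
move=> e0 ue.
have cu : cauchy (u @ \oo).
  apply/cauchy_ballP => eps eps0; near_simpl.
  have [r er] : exists r : R, eps = r%:C.
    by exists (complex.Re eps); rewrite RRe_real// gtr0_real.
  have r0 : 0 < r by move: eps0; rewrite er ltcR.
  have [N NP] := e0 _ r0.
  have Nc : \forall n \near \oo, (N <= n)%N by exists N.
  near=> nm => /=.
  have n1 : (N <= nm.1)%N by near: nm; apply: (cvg_fst Nc).
  have n2 : (N <= nm.2)%N by near: nm; apply: (cvg_snd Nc).
  rewrite -ball_normE /= er -rnormK ltcR.
  have [le|/ltnW le] := leqP nm.1 nm.2.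
    by rewrite rnormB (le_lt_trans (ue _ _ le))// NP.
  by rewrite (le_lt_trans (ue _ _ le))// NP.
have /cauchy_cvgP/cvg_ex[l ul] := cu.
exists l => n; apply/ler_addgt0Pr => d d0.
have d0' : 0 < d%:C :> R[i] by rewrite ltcR.
have /cvgrPdist_lt/(_ _ d0') [N _ NP] := ul.
have := NP (maxn N n) (leq_maxl _ _); rewrite /= -rnormK ltcR => lN.
rewrite -[l - u n](subrKA (u (maxn N n))) (le_trans (rnormD _ _))// addrC.
by rewrite lerD ?ue ?leq_maxr// ltW.
Unshelve. all: by end_near. Qed.

Lemma rnorm_geometric_cvg H (u : nat -> H) (c q : R) : 0 <= q < 1 -> 0 <= c ->
  (forall n, rnorm (u n.+1 - u n) <= c * q ^+ n) ->
  exists l, forall n, rnorm (l - u n) <= c / (1 - q) * q ^+ n.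
Proof.
move=> /andP[q0 q1] c0 uq; apply: rnorm_cauchy_cvg => [d d0|n m /subnK <-].
  (* The summand 1 keeps the divisor positive when [c = 0]. *)
  have c'0 : 0 < c / (1 - q) + 1.
    by rewrite ltr_wpDl// divr_ge0// subr_ge0 ltW.
  have [N NP] := @expr_lt_eventually q _ ltac:(exact/andP) (divr_gt0 d0 c'0).
  exists N => n /NP; rewrite ltr_pdivlMr// mulrC => /(le_lt_trans _); apply.
  by rewrite ler_wpM2r ?exprn_ge0// lerDl.
have q1' : 1 - q != 0 by rewrite subr_eq0 eq_sym lt_eqF.
(* The exact partial sum of the geometric series, rather than its total, makes the induction on
   [m - n] close. *)
suff /le_trans : rnorm (u (m - n + n)%N - u n) <=
    c / (1 - q) * (q ^+ n - q ^+ (m - n + n)).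
  apply; rewrite ler_wpM2l ?gerBl ?exprn_ge0//.
  by rewrite divr_ge0// subr_ge0 ltW.
elim: (m - n)%N => [|k IH]; first by rewrite add0n !subrr rnorm0 mulr0.
rewrite addSn -[u (k + n).+1 - u n](subrKA (u (k + n)%N)).
rewrite (le_trans (rnormD _ _))// (le_trans (lerD (uq _) IH))//.
by rewrite exprS le_eqVlt; apply/orP; left; apply/eqP; field.
Qed.

(** * The Hellinger-Toeplitz theorem *)

Definition rsymmetric H (T : H -> H) := forall x y, rinner (T x) y = rinner x (T y).

(** If [T] were unbounded, one could build a single vector [l] whose inner products with suitable
    [T (y n)] are too large: by symmetry they equal [rinner (T l) (y n)], which is at most
    [rnorm (T l) * rnorm (y n)]. *)
Lemma hellinger_toeplitz H (T : H -> H) : rsymmetric T ->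
  exists2 M : R, 0 < M & forall x, rnorm (T x) <= M * rnorm x.
Proof.
move=> symT; apply: contrapT => unbounded.
have p0 n : 0 < 3^-1 ^+ n :> R by rewrite exprn_gt0// invr_gt0.
have /choice[y yP] : forall n, exists y : H,
    n.+1%:R * rnorm y < 3^-1 ^+ n * rnorm (T y).
  move=> n; apply: contrapT => /forallNP small; apply: unbounded.
  exists (n.+1%:R / 3^-1 ^+ n) => [|x]; first by rewrite divr_gt0 ?ltr0n.
  have /negP := small x; rewrite -leNgt => sx.
  by rewrite mulrAC ler_pdivlMr// mulrC.
pose w n := T (y n).
(* Gliding hump: the limit of [u] is moved along [w n] by an amount [3^-n] that
   the later steps, of total size at most [3^-n / 2], cannot cancel. *)
pose step n (x : H) : R :=
  (if 0 <= rinner x (w n) then 1 else -1) * (3^-1 ^+ n / rnorm (w n)).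
pose u := fix u n : H := if n is m.+1 then u m + (step m (u m))%:C *: w m else 0.
have w0 n : 0 < rnorm (w n).
  rewrite -(pmulr_rgt0 _ (p0 n)); apply: le_lt_trans (yP n).
  by rewrite mulr_ge0 ?rnorm_ge0.
have us n : rnorm (u n.+1 - u n) <= 1 * 3^-1 ^+ n.
  rewrite /= addrC addKr rnormZ normrM (@ger0_norm _ (_ / _)).
    by rewrite -mulrA divfK ?gt_eqF// /step; case: ifP; rewrite ?normrN normr1.
  by rewrite divr_ge0 ?ltW.
have [||l lP] := @rnorm_geometric_cvg H u 1 3^-1 _ _ us; [lra|lra|].
have lw n : 3^-1 ^+ n * rnorm (w n) <= 2 * `|rinner l (w n)|.
  have : 3^-1 ^+ n * rnorm (w n) <= `|rinner (u n.+1) (w n)|.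
    rewrite /= !rinnerE rinner_rnorm /step.
    have -> b : b * (3^-1 ^+ n / rnorm (w n)) * rnorm (w n) ^+ 2 =
      b * (3^-1 ^+ n * rnorm (w n)).
      by field; rewrite gt_eqF ?w0.
    have := mulr_gt0 (p0 n) (w0 n).
    case: ifP => [r0 p|/negbT]; first by rewrite ger0_norm; lra.
    by rewrite -ltNge => r0 p; rewrite ltr0_norm; lra.
  have : `|rinner (l - u n.+1) (w n)| <= 2^-1 * (3^-1 ^+ n * rnorm (w n)).
    rewrite (le_trans (rinner_le _ _))// mulrA ler_wpM2r ?rnorm_ge0//.
    rewrite (le_trans (lP _))// (_ : 1 / (1 - 3^-1) = 3 / 2 :> R); last by field.
    by rewrite exprS; have := p0 n; lra.
  rewrite rinnerE rinnerNl distrC => /(le_trans (lerB_dist _ _)); lra.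
(* This index makes [n.+1] exceed [2 * rnorm (T l)], contradicting the choice of [y n]. *)
have := yP (Num.truncn (2 * rnorm (T l))).
set n := Num.truncn _; apply/negP; rewrite -leNgt (le_trans (lw n))//.
rewrite /w -symT (le_trans (ler_wpM2l _ (rinner_le _ _)))// mulrA.
by rewrite ler_wpM2r ?rnorm_ge0// ltW// truncnS_gt.
Qed.

(** * Nonnegativity and the bottom of the numerical range *)

Lemma linear_map0 H K (T : H -> K) : linear T -> T 0 = 0.
Proof. by move=> lT; have := lT (-1) 0 0; rewrite scaler0 addr0 scaleN1r addNr. Qed.

Lemma linear_mapB H K (T : H -> K) : linear T -> {morph T : x y / x - y}.
Proof. by move=> lT x y; rewrite -scaleN1r addrC lT scaleN1r addrC. Qed.

Definition shiftop H (T : H -> H) (m : R) (x : H) : H := T x + m%:C *: x.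

Lemma rsymmetric_shiftop H (T : H -> H) (m : R) :
  rsymmetric T -> rsymmetric (shiftop T m).
Proof. by move=> sT x y; rewrite /shiftop !rinnerE sT. Qed.

(* Nonnegativity of [P] is tested on [x - M^-1 P x]. *)
Lemma nonneg_norm_le H (P : H -> H) (M : R) : linear P -> rsymmetric P ->
  (forall x, 0 <= rinner (P x) x) ->
  0 < M -> (forall x, rnorm (P x) <= M * rnorm x) ->
  forall x, rnorm (P x) ^+ 2 <= M * rinner (P x) x.
Proof.
move=> lP sP P0 M0 PM x.
have Q : rinner (P (P x)) (P x) <= M * rnorm (P x) ^+ 2.
  rewrite (le_trans (ler_norm _))// (le_trans (rinner_le _ _))// expr2 mulrA.
  by rewrite ler_wpM2r ?rnorm_ge0.
have i0 : 0 < M^-1 by rewrite invr_gt0.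
have := P0 ((- M^-1)%:C *: P x + x).
have := ler_wpM2l (ltW (mulr_gt0 i0 i0)) Q.
rewrite lP !rinnerE (sP _ x) rinner_rnorm.
rewrite (_ : M^-1 / M * (M * _) = M^-1 * rnorm (P x) ^+ 2); last by field; rewrite gt_eqF.
move=> Q1 Q2; rewrite -ler_pdivrMl//; lra.
Qed.

(** A right inverse [Q] of [P] is symmetric, hence bounded by Hellinger-Toeplitz, and it is also a
    left inverse because the kernel of [P] is orthogonal to its range. So
    [rnorm x <= N * rnorm (P x)], while [rnorm (P x) ^+ 2 <= M * rinner (P x) x]. *)
Lemma nonneg_onto_coercive H (P : H -> H) : linear P -> rsymmetric P ->
  (forall x, 0 <= rinner (P x) x) -> (forall y, exists x, P x = y) ->
  exists2 c : R, 0 < c & forall x, c * rnorm x ^+ 2 <= rinner (P x) x.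
Proof.
move=> lP sP P0 Ponto; have /choice[Q PQ] := Ponto.
have sQ : rsymmetric Q by move=> x y; rewrite -{2}(PQ x) sP PQ.
have QP x : Q (P x) = x.
  have : P (Q (P x) - x) = 0 by rewrite (linear_mapB lP) PQ subrr.
  move: (_ - x) (subrK x (Q (P x))) => z <- Pz.
  rewrite (_ : z = 0) ?add0r//; apply: rnorm_eq0; apply/eqP.
  by rewrite -sqrf_eq0 -rinner_rnorm -{2}(PQ z) -sP Pz /rinner linear0l.
have [M M0 PM] := hellinger_toeplitz sP.
have [N N0 QN] := hellinger_toeplitz sQ.
exists (N ^+ 2 * M)^-1 => [|x]; first by rewrite invr_gt0 mulr_gt0 ?exprn_gt0.
rewrite ler_pdivrMl ?mulr_gt0 ?exprn_gt0// -mulrA.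
have := nonneg_norm_le lP sP P0 M0 PM x.
move=> /(ler_wpM2l (exprn_ge0 2 (ltW N0))); apply: le_trans.
have := QN (P x); rewrite QP => xN.
by rewrite -exprMn lerXn2r ?nnegrE ?rnorm_ge0// mulr_ge0 ?rnorm_ge0 ?ltW.
Qed.

Lemma shiftop_linear H (T : H -> H) m : linear T -> linear (shiftop T m).
Proof.
move=> lT a x y; rewrite /shiftop lT !scalerDr !scalerA [m%:C * a]mulrC.
by rewrite -!addrA; congr (_ + _); rewrite addrCA.
Qed.

(** Consider the least [m >= 0] for which [T + m] is nonnegative. If it were positive, [T + m] would
    be onto, hence coercive, and [m] could be lowered further. *)
Lemma onto_shiftop_nonneg H (T : H -> H) : linear T -> rsymmetric T ->
  (forall m, 0 < m -> forall y, exists x, shiftop T m x = y) ->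
  forall x, 0 <= rinner (T x) x.
Proof.
move=> lT sT Tonto.
have [M M0 TM] := hellinger_toeplitz sT.
have shiftE m x : rinner (shiftop T m x) x = rinner (T x) x + m * rnorm x ^+ 2.
  by rewrite /shiftop !rinnerE rinner_rnorm.
pose E := [set m : R | 0 <= m /\ forall x, 0 <= rinner (shiftop T m x) x].
have E0 : has_inf E.
  split; last by exists 0 => m [].
  exists M; split=> [|x]; first exact: ltW.
  have := le_trans (rinner_le (T x) x) (ler_wpM2r (rnorm_ge0 x) (TM x)).
  by rewrite shiftE => /lerNnormlW; lra.
(* The infimum is attained: each nonzero [x] only requires [m] to be at least
   [- rinner (T x) x / rnorm x ^+ 2], and a lower bound of [E] stays below [inf E]. *)
have infE : E (inf E).
  split; first by apply: lb_le_inf => [|m []//]; case: E0.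
  move=> x; rewrite shiftE; have [/rnorm_eq0 x0|x0] := eqVneq (rnorm x) 0.
    by rewrite {2 3}x0 rnorm0 /rinner linear0r/= expr0n mulr0 addr0.
  have n0 : 0 < rnorm x ^+ 2 by rewrite exprn_gt0// lt_def x0 rnorm_ge0.
  suff : - rinner (T x) x / rnorm x ^+ 2 <= inf E by rewrite ler_pdivrMr//; lra.
  apply: lb_le_inf => [|m [_ /(_ x)]]; first by case: E0.
  by rewrite shiftE ler_pdivrMr//; lra.
have [m0 mP] := infE; have [mE|/negbTE mn0] := eqVneq (inf E) 0.
  by move=> x; have := mP x; rewrite shiftE mE mul0r addr0.
have mp : 0 < inf E by rewrite lt_def mn0.
have [c c0 cP] := nonneg_onto_coercive (shiftop_linear _ lT)
  (rsymmetric_shiftop _ sT) mP (Tonto _ mp).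
(* The minimum keeps the lowered shift nonnegative, as membership in [E] demands. *)
have : E (inf E - Num.min c (inf E)).
  split=> [|x]; first by rewrite subr_ge0 ge_min lexx orbT.
  have := cP x; rewrite !shiftE mulrBl.
  have : Num.min c (inf E) * rnorm x ^+ 2 <= c * rnorm x ^+ 2.
    by rewrite ler_wpM2r ?exprn_ge0 ?rnorm_ge0// ge_min lexx.
  lra.
by move=> /(ge_inf E0.2); rewrite lerBrDl gerDr leNgt lt_min c0 mp.
Qed.

(** * Coercive operators, surjectivity and adjoint graphs *)

Lemma coercive_contraction H (P : H -> H) (m L : R) : 0 < m -> 0 < L ->
  (forall x, m * rnorm x ^+ 2 <= rinner (P x) x) ->
  (forall x, rnorm (P x) <= L * rnorm x) ->
  exists t q : R, [/\ 0 < t, 0 <= q < 1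
    & forall x, rnorm (x - t%:C *: P x) <= q * rnorm x].
Proof.
move=> m0 L0 Pm PL.
have L20 : 0 < L ^+ 2 by rewrite exprn_gt0.
(* Expanding the square bounds [rnorm (x - t P x) ^+ 2] by [1 - 2 t m + t^2 L^2] times
   [rnorm x ^+ 2]. This [t] minimizes the factor, with minimum [1 - t m]. *)
pose t := m / L ^+ 2; have t0 : 0 < t by rewrite divr_gt0.
exists t, (Num.sqrt (1 - t * m)); split=> // [|x].
  rewrite sqrtr_ge0 -[ltRHS]sqrtr1 ltr_sqrt ?ltr01// gtrBl mulr_gt0//.
have le : rnorm (x - t%:C *: P x) ^+ 2 <= (1 - t * m) * rnorm x ^+ 2.
  rewrite -rinner_rnorm !rinnerE (rinnerC x (P x)) !rinner_rnorm.
  have : rnorm (P x) ^+ 2 <= L ^+ 2 * rnorm x ^+ 2.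
    by rewrite -exprMn lerXn2r ?nnegrE ?rnorm_ge0// mulr_ge0 ?rnorm_ge0 ?ltW.
  move=> /(ler_wpM2l (ltW (mulr_gt0 t0 t0))).
  rewrite (_ : t * t * (L ^+ 2 * _) = t * (m * rnorm x ^+ 2)); last first.
    by rewrite /t; field; rewrite gt_eqF.
  have := ler_wpM2l (ltW t0) (Pm x); lra.
(* In the zero space [1 - t * m] may be negative, and [Num.sqrt] then returns 0. Only a vector of
   nonzero norm shows that it is nonnegative. *)
have [x0|x0] := eqVneq (rnorm x) 0.
  by move: le; rewrite x0 expr0n mulr0/= mulr0 exprn_even_le0//= => /eqP->.
have n0 : 0 < rnorm x ^+ 2 by rewrite exprn_gt0// lt_def x0 rnorm_ge0.
have q0 : 0 <= 1 - t * m.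
  by rewrite -(pmulr_lge0 _ n0) (le_trans _ le)// exprn_ge0 ?rnorm_ge0.
by rewrite -ler_sqr ?nnegrE ?mulr_ge0 ?sqrtr_ge0 ?rnorm_ge0// exprMn sqr_sqrtr.
Qed.

(** Solutions of [P x = y] are the fixed points of [x - t P x + t y], a contraction for the [t] of
    [coercive_contraction]; its iterates from 0 converge. *)
Lemma coercive_onto H (P : H -> H) (m L : R) : linear P -> 0 < m -> 0 < L ->
  (forall x, m * rnorm x ^+ 2 <= rinner (P x) x) ->
  (forall x, rnorm (P x) <= L * rnorm x) ->
  forall y, exists x, P x = y.
Proof.
move=> lP m0 L0 Pm PL y.
have [t [q [t0 q01 Bq]]] := coercive_contraction m0 L0 Pm PL.
pose f x := x - t%:C *: P x + t%:C *: y.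
have fB a b : rnorm (f a - f b) <= q * rnorm (a - b).
  suff -> : f a - f b = (a - b) - t%:C *: P (a - b) by [].
  by rewrite /f (linear_mapB lP) scalerBr opprD addrACA subrr addr0 !opprD addrACA.
pose u n := iter n f 0.
have uq n : rnorm (u n.+1 - u n) <= rnorm (f 0) * q ^+ n.
  elim: n => [|n IH]; first by rewrite /= subr0 mulr1.
  rewrite (le_trans (fB _ _))// exprS mulrCA ler_wpM2l//; by case/andP: q01.
have [l lP'] := rnorm_geometric_cvg q01 (rnorm_ge0 _) uq.
exists l; suff fl : f l = l.
  have : t%:C *: (y - P l) = 0.
    apply: (addrI l); rewrite addr0 -[RHS]fl /f -addrA scalerBr.
    rewrite [in LHS](addrC (t%:C *: y)); exact: erefl.
  move=> /eqP; rewrite scaler_eq0 subr_eq0 eq_sym => /orP[|/eqP//].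
  by move=> /eqP/(congr1 (@complex.Re R)) /= t00; move: t0; rewrite t00 ltxx.
apply/eqP; rewrite -subr_eq0; apply/eqP/rnorm_eq0/eqP.
rewrite eq_le rnorm_ge0 andbT; apply/ler_addgt0Pl => e e0; rewrite addr0.
set c := rnorm (f 0) / (1 - q) in lP'.
have c0 : 0 <= c by rewrite divr_ge0 ?rnorm_ge0// subr_ge0 ltW//; case/andP: q01.
(* Both [f l - f (u N)] and [u N.+1 - l] have norm at most [c * q ^+ N.+1], which accounts for the
   factor 2. *)
have c10 : 0 < 2 * c + 1 by rewrite ltr_wpDl// mulr_ge0.
have [N /(_ N (leqnn _))] := expr_lt_eventually q01 (divr_gt0 e0 c10).
rewrite ltr_pdivlMr// => qN.
have := rnormD (f l - u N.+1) (u N.+1 - l).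
rewrite subrKA => /le_trans; apply.
have -> : u N.+1 = f (u N) by [].
have := le_trans (fB l (u N)) (ler_wpM2l (andP q01).1 (lP' N)).
have := lP' N.+1; rewrite [rnorm (l - u _)]rnormB.
have -> : u N.+1 = f (u N) by [].
have qN0 : 0 <= q ^+ N by rewrite exprn_ge0//; case/andP: q01.
have : q ^+ N.+1 <= q ^+ N.
  by rewrite exprS ler_piMl//; case/andP: q01 => _ /ltW.
move=> /(ler_wpM2l c0); rewrite !exprS; lra.
Qed.

(* The functional [phi x = '[S x, g] - '[x, h]] vanishes on the range of
   [A + m] restricted to [dom S], hence [phi x = phi (B x)] for the contraction
   [B = I - t (A + m)], and iterating [B] shows that [phi = 0]. *)
Lemma adjoint_graph_shiftop_preimage H (S : pre_operator H) (A : H -> H)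
    (m L : R) (f f' g h : H) :
  linear_operator S -> (forall x y, '[A x, y] = '[x, A y]) ->
  (forall x, 0 <= rinner (A x) x) -> 0 < m -> 0 < L ->
  (forall x, rnorm (shiftop A m x) <= L * rnorm x) ->
  (forall x, dom S x -> dom S (A x) /\ S (A x) = A (S x)) ->
  adjoint_graph S f f' -> shiftop A m g = f -> shiftop A m h = f' ->
  adjoint_graph S g h.
Proof.
move=> [[S0 Sdom] Slin] sA A0 m0 L0 AL AS Sff' gf hf'.
have Pm x : m * rnorm x ^+ 2 <= rinner (shiftop A m x) x.
  by rewrite /shiftop rinnerDl rinnerZl rinner_rnorm lerDr.
have [t [q [t0 q01 Bq]]] := coercive_contraction m0 L0 Pm AL.
set P := shiftop A m in Bq.
have sP x y : '[P x, y] = '[x, P y].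
  by rewrite /P /shiftop innerDl innerDr sA innerZl innerZr conj_realC.
have SZ a x : dom S x -> dom S (a *: x) /\ S (a *: x) = a *: S x.
  move=> Sx; have Sz : S 0 = 0.
    by have := Slin (-1) _ _ S0 S0; rewrite scaler0 addr0 scaleN1r addNr.
  by have := Slin a _ _ Sx S0; have := Sdom a _ _ Sx S0; rewrite Sz !addr0.
have SD x y : dom S x -> dom S y -> dom S (x + y) /\ S (x + y) = S x + S y.
  by move=> Sx Sy; have := Slin 1 _ _ Sx Sy; have := Sdom 1 _ _ Sx Sy; rewrite !scale1r.
have SP x : dom S x -> dom S (P x) /\ S (P x) = P (S x).
  move=> Sx; have [SA SAx] := AS _ Sx; have [Sm Smx] := SZ m%:C _ Sx.
  by have [? SPx] := SD _ _ SA Sm; split; rewrite // SPx SAx Smx.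
rewrite -/(P g) -/(P h) in gf hf'; clearbody P.
pose B x := x - t%:C *: P x.
have SB x : dom S x -> dom S (B x) /\ S (B x) = B (S x).
  move=> Sx; have [SPd SPx] := SP _ Sx; have [St Stx] := SZ (- t%:C) _ SPd.
  by rewrite /B -!scaleNr; have [? SBx] := SD _ _ Sx St; split; rewrite // SBx Stx SPx.
pose phi x := '[S x, g] - '[x, h].
have phiP x : dom S x -> phi (P x) = 0.
  move=> Sx; have [_ SPx] := SP _ Sx.
  by rewrite /phi SPx !sP gf hf' (Sff' _ Sx) subrr.
have phiB x : dom S x -> phi (B x) = phi x.
  move=> Sx; have [SPd SPx] := SP _ Sx; have [_ SBx] := SB _ Sx.
  transitivity (phi x - t%:C * phi (P x)); last by rewrite phiP// mulr0 subr0.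
  rewrite /phi SBx SPx /B -!(scaleNr t%:C (P _)) !innerDl !innerZl; ring.
have Bn x n : dom S x -> [/\ dom S (iter n B x), S (iter n B x) = iter n B (S x)
    & phi (iter n B x) = phi x].
  move=> Sx; elim: n => [//|n [Bd Bx phx]] /=.
  by have [? SBx] := SB _ Bd; split; rewrite // ?SBx ?Bx// phiB.
have rB x n : rnorm (iter n B x) <= q ^+ n * rnorm x.
  elim: n => [|n IH] /=; first by rewrite mul1r.
  rewrite (le_trans (Bq _))// exprS -mulrA ler_wpM2l//; by case/andP: q01.
have phi0 x : dom S x -> complex.Re (phi x) = 0.
  move=> Sx; apply/eqP; rewrite -normr_eq0 eq_le normr_ge0 andbT.
  apply/ler_addgt0Pl => e e0; rewrite addr0.
  (* By Cauchy-Schwarz the real part of [phi (iter N B x)], which equals that of [phi x], is at most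
     [q ^+ N * c] in absolute value. *)
  pose c := rnorm (S x) * rnorm g + rnorm x * rnorm h.
  have c0 : 0 <= c by rewrite addr_ge0 ?mulr_ge0 ?rnorm_ge0.
  have c10 : 0 < c + 1 by rewrite ltr_wpDl.
  have [N /(_ N (leqnn _))] := expr_lt_eventually q01 (divr_gt0 e0 c10).
  have qN0 : 0 <= q ^+ N by rewrite exprn_ge0//; case/andP: q01.
  rewrite ltr_pdivlMr// => qN.
  have [_ SBx <-] := Bn x N Sx.
  rewrite /phi ReB SBx (le_trans (ler_normB _ _))//.
  have := ler_wpM2r (rnorm_ge0 g) (rB (S x) N).
  have := ler_wpM2r (rnorm_ge0 h) (rB x N).
  have := rinner_le (iter N B (S x)) g; have := rinner_le (iter N B x) h.
  rewrite /rinner; rewrite /c in qN *; lra.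
move=> x Sx; apply/eqP; rewrite -subr_eq0 -/(phi x); apply/eqP.
(* Since [phi ('i *: x)] is ['i * phi x], its real part controls the imaginary part of [phi x]. *)
have [Six Sixx] := SZ 'i _ Sx.
have := phi0 _ Six; rewrite /phi Sixx !innerZl -mulrBr -/(phi x) -complexiE.
have := phi0 _ Sx; case: (phi x) => a b /= ->.
by rewrite mul0r mul1r sub0r => /eqP; rewrite oppr_eq0 => /eqP ->.
Qed.

(** * Adjoints and boundary images *)

Lemma innerNr H (x z : H) : '[z, - x] = - '[z, x].
Proof. by rewrite linearNr. Qed.

(** For [z != 0], density gives [x] in [A] with [rnorm (z - x) < rnorm z], but
    [rinner (z - x) z = rnorm z ^+ 2] contradicts Cauchy-Schwarz. *)
Lemma dense_inner_eq0 H (A : set H) (z : H) : dense A ->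
  (forall x, A x -> '[x, z] = 0) -> z = 0.
Proof.
move=> dA zA; apply: contrapT => z0.
have nz : 0 < `|z| :> R[i] by rewrite normr_gt0; apply/eqP.
have [||x [xz Ax]] := dA ((ball z `|z|)°).
- exists z; exact: nbhsx_ballx.
- exact: open_interior.
have /= := interior_subset xz; rewrite -ball_normE /= -!rnormK ltcR.
have := rinner_le (z - x) z.
rewrite rinnerDl rinnerNl rinner_rnorm /rinner (zA _ Ax) subr0 expr2.
rewrite ger0_norm ?mulr_ge0 ?rnorm_ge0// ler_pM2r; last by rewrite -ltcR rnormK.
by move=> le lt; move: (le_lt_trans le lt); rewrite ltxx.
Qed.

Lemma inner_inj H (y z : H) : (forall x, '[x, y] = '[x, z]) -> y = z.
Proof.
move=> yz; apply/eqP; rewrite -subr_eq0; apply/eqP/rnorm_eq0/eqP.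
rewrite -sqrf_eq0 -rinner_rnorm /rinner innerDr innerNr yz subrr.
exact/eqP.
Qed.

Lemma adjoint_graph_adjoint H (S : pre_operator H) y :
  dom (adjoint S) y -> adjoint_graph S y (adjoint S y).
Proof. by case=> z zP; apply: (xgetPex 0); exists z. Qed.

(** Density makes the second component of the adjoint graph unique, so the value picked by [xget]
    must be [z]. *)
Lemma adjointE H (S : pre_operator H) y z : densely_defined S ->
  adjoint_graph S y z -> dom (adjoint S) y /\ adjoint S y = z.
Proof.
move=> dS yz; have dy : dom (adjoint S) y by exists z.
split=> //; apply/eqP; rewrite -subr_eq0; apply/eqP.
apply: (dense_inner_eq0 dS) => x Sx.
by rewrite innerDr innerNr -(yz _ Sx) (adjoint_graph_adjoint dy Sx) subrr.
Qed.

Lemma self_adjoint_totalP H (T : H -> H) :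
  self_adjoint (Defs.total T) <-> forall x y, '[T x, y] = '[x, T y].
Proof.
split=> [[domT TE] x y|sT].
  have dy : dom (adjoint (Defs.total T)) y by rewrite -domT.
  by have /= -> := TE y I; apply: adjoint_graph_adjoint dy _ I.
have gT y : adjoint_graph (Defs.total T) y (T y) by move=> x _; apply: sT.
split=> [|y _]; first by apply/seteqP; split=> y _ //; exists (T y).
apply: inner_inj => x; rewrite -sT.
by apply: (@adjoint_graph_adjoint H (Defs.total T)) => //; exists (T y).
Qed.

Lemma commutes_withP H (S : pre_operator H) (C : H -> H) : commutes_with S C ->
  forall x, dom S x -> dom S (C x) /\ S (C x) = C (S x).
Proof.
move=> [domE CE] x Sx.
have : dom (op_comp S (Defs.total C)) x by rewrite domE.
by move=> SCx; split; [case: SCx|apply: CE].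
Qed.

(** Here [B'] is the adjoint of [B]. Keeping the two apart covers [C alpha], which need not be
    symmetric. *)
Lemma adjoint_graph_image H (S : pre_operator H) (B B' : H -> H) y z :
  (forall x, dom S x -> dom S (B x) /\ S (B x) = B (S x)) ->
  (forall x y, '[B x, y] = '[x, B' y]) ->
  adjoint_graph S y z -> adjoint_graph S (B' y) (B' z).
Proof.
by move=> SB BB' yz x Sx; have [SBx e] := SB x Sx; rewrite -!BB' -e yz.
Qed.

(** Take [f] with boundary values [(0, x)] and [g] with [(y, 0)]. Green's identity for [(B f, g)]
    yields ['[b x, y]], for [(f, B g)] it yields ['[x, b y]], and the left-hand sides agree because
    [B] is symmetric and commutes with the adjoint of [S]. *)
Lemma boundary_image_symmetric H K (S : pre_operator H) (G0 G1 : H -> K)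
    (B : H -> H) (b : K -> K) :
  boundary_triplet S G0 G1 -> linear b ->
  (forall x y, '[B x, y] = '[x, B y]) ->
  (forall f, dom (adjoint S) f ->
     dom (adjoint S) (B f) /\ adjoint S (B f) = B (adjoint S f)) ->
  (forall f, dom (adjoint S) f -> b (G0 f) = G0 (B f) /\ b (G1 f) = G1 (B f)) ->
  forall x y : K, '[b x, y] = '[x, b y].
Proof.
move=> [lG0 lG1 green onto] lb sB SB bG x y.
have b0 := linear_map0 lb.
have [f [df f0 f1]] := onto 0 x.
have [g [dg g0 g1]] := onto y 0.
have [dBf SBf] := SB _ df; have [dBg SBg] := SB _ dg.
have [bf0 bf1] := bG _ df; have [bg0 bg1] := bG _ dg.
have := green _ _ dBf dg; have := green _ _ df dBg.
rewrite SBf SBg !sB -bf0 -bf1 -bg0 -bg1 f0 f1 g0 g1 b0.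
by rewrite !linear0l !subr0 => -> ->.
Qed.

(** A symmetric involution is isometric, since ['[b x, b x] = '[x, b (b x)] = '[x, x]]; this gives
    the bound 1. *)
Lemma fundamental_symmetry_norm K (b : K -> K) : linear b ->
  (forall x y, '[b x, y] = '[x, b y]) -> (forall x, b (b x) = x) ->
  fundamental_symmetry b.
Proof.
move=> lb sb bb; split=> //; last exact/self_adjoint_totalP.
split=> //; exists 1 => x; rewrite mul1r.
by rewrite -(@ler_pXn2r _ 2)// ?nnegrE// !normr_inner sb bb.
Qed.

Lemma symmetric_bounded K (b : K -> K) : linear b ->
  (forall x y, '[b x, y] = '[x, b y]) -> bounded_operator b.
Proof.
move=> lb sb.
have [|M _ bM] := @hellinger_toeplitz K b; first by move=> x y; rewrite /rinner sb.
by split=> //; exists M => x; rewrite -!rnormK -rmorphM lecR.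
Qed.

Lemma symmetric_inner_real K (b : K -> K) x : (forall x y, '[b x, y] = '[x, b y]) ->
  '[b x, x] = (rinner (b x) x)%:C.
Proof.
by move=> sb; rewrite /rinner RRe_real// CrealE -innerC sb.
Qed.

End HilbertSpaces.

Theorem lemma3p14 (R : realType) (H : hilbertType R)
    (S : pre_operator H) (J : H -> H)
    (hSsym : symmetric_operator S) (hSdense : densely_defined S)
    (hSdef : equal_defect_numbers S)
    (hJ : fundamental_symmetry J) (hJnt : nontrivial_symmetry J)
    (hSJ : commutes_with S J)
    (D : Type) (C : D -> H -> H)
    (hC : forall T : H -> H, C_symmetry S J T <-> exists alpha : D, C alpha = T)
    (K : hilbertType R) (G0 G1 : H -> K)
    (hG : boundary_triplet S G0 G1)
    (cC : D -> K -> K)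
    (hcC : forall alpha : D, boundary_image S G0 G1 (C alpha) (cC alpha))
    (alphaJ : D) (hJalpha : C alphaJ = J) :
  (forall alpha : D,
     (forall x : K, cC alpha (cC alpha x) = x) /\
     positive_operator (fun x : K => cC alphaJ (cC alpha x))) /\
  fundamental_symmetry (cC alphaJ).
Proof.
have [[lJ _] /self_adjoint_totalP sJ JJ] := hJ.
have SJ := commutes_withP hSJ.
have [linS _] := hSsym.
have JS f f' : adjoint_graph S f f' -> adjoint_graph S (J f) (J f').
  exact: adjoint_graph_image SJ sJ.
have onG0 x : exists2 f, dom (adjoint S) f & G0 f = x.
  by have [_ _ _ /(_ x 0)[f [df f0 _]]] := hG; exists f.
have Csym alpha : C_symmetry S J (C alpha) by apply/hC; exists alpha.
have CS alpha f f' : adjoint_graph S f f' -> adjoint_graph S (C alpha f) (C alpha f').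
  have [_ CC [_ /self_adjoint_totalP sA _] /commutes_withP SC] := Csym alpha.
  (* Symmetry of [J \o C alpha] and [J (J x) = x] make [J \o C alpha \o J] the operator whose
     adjoint is [C alpha]; it commutes with [S] factor by factor. *)
  apply: (@adjoint_graph_image _ _ _ (J \o C alpha \o J)) => [x Sx|x y] /=.
    have [Sx1 Ex1] := SJ _ Sx; have [Sx2 Ex2] := SC _ Sx1; have [Sx3 Ex3] := SJ _ Sx2.
    by rewrite Ex3 Ex2 Ex1.
  by have := sA (J x) y; rewrite /= => ->; rewrite sJ JJ.
have adj f : dom (adjoint S) f -> adjoint_graph S f (adjoint S f).
  exact: adjoint_graph_adjoint.
have cc alpha x : cC alpha (cC alpha x) = x.
  have [f df <-] := onG0 x.
  have [_ bG] := hcC alpha; have [_ CC _ _] := Csym alpha.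
  have [dCf _] := adjointE hSdense (CS alpha _ _ (adj _ df)).
  by rewrite (bG _ df).1 (bG _ dCf).1 CC.
have [lcJ cJ] := hcC alphaJ; rewrite hJalpha in cJ.
have scJ : forall x y, '[cC alphaJ x, y] = '[x, cC alphaJ y].
  apply: (boundary_image_symmetric hG lcJ sJ _ cJ) => f df.
  exact: (adjointE hSdense (JS _ _ (adj _ df))).
split=> [alpha|]; last exact: fundamental_symmetry_norm.
split=> //.
have [lc cG] := hcC alpha.
have [_ CC [[lA [M0 AM0]] /self_adjoint_totalP sA Apos] /commutes_withP SC] := Csym alpha.
set A := J \o C alpha in lA AM0 sA Apos.
have SA x : dom S x -> dom S (A x) /\ S (A x) = A (S x).
  move=> Sx; have [Sx1 Ex1] := SC _ Sx; have [Sx2 Ex2] := SJ _ Sx1.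
  by rewrite /A /= Ex2 Ex1.
pose a x := cC alphaJ (cC alpha x).
have la : linear a by move=> k x y; rewrite /a lc lcJ.
have aG f : dom (adjoint S) f -> a (G0 f) = G0 (A f) /\ a (G1 f) = G1 (A f).
  move=> df; have [dCf _] := adjointE hSdense (CS alpha _ _ (adj _ df)).
  by rewrite /a (cG _ df).1 (cJ _ dCf).1 (cG _ df).2 (cJ _ dCf).2.
have sa : forall x y, '[a x, y] = '[x, a y].
  apply: (boundary_image_symmetric hG la sA _ aG) => f df.
  exact: (adjointE hSdense (JS _ _ (CS alpha _ _ (adj _ df)))).
have rsa : rsymmetric a by move=> x y; rewrite /rinner sa.
have A0 x : 0 <= rinner (A x) x.
  have [->|/Apos] := eqVneq x 0; first by rewrite /rinner linear0r.
  by rewrite (symmetric_inner_real _ sA) ltcR => /ltW.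
have [|M M_gt0 AM] := @hellinger_toeplitz _ H A; first by move=> x y; rewrite /rinner sA.
have a_onto m : 0 < m -> forall y, exists x, shiftop a m x = y.
  move=> m0 y; have [f df <-] := onG0 y.
  have L0 : 0 < M + m by rewrite addr_gt0.
  have AL x : rnorm (shiftop A m x) <= (M + m) * rnorm x.
    by rewrite (le_trans (rnormD _ _))// rnormZ gtr0_norm// mulrDl lerD2r.
  have Am x : m * rnorm x ^+ 2 <= rinner (shiftop A m x) x.
    by rewrite /shiftop rinnerDl rinnerZl rinner_rnorm lerDr.
  have Aonto := coercive_onto (shiftop_linear m lA) m0 L0 Am AL.
  (* Two equations are solved, [(A + m) g = f] and [(A + m) h = S^* f], so that [h] can serve as
     [S^* g]. This puts [g] in the domain of the adjoint, and [G0 g] is then the preimage of [G0 f]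
     under [a + m]. *)
  have [g gf] := Aonto f; have [h hf] := Aonto (adjoint S f).
  have gh := adjoint_graph_shiftop_preimage linS sA A0 m0 L0 AL SA (adj _ df) gf hf.
  have [dg _] := adjointE hSdense gh.
  have [dAg _] := adjointE hSdense (JS _ _ (CS alpha _ _ gh)).
  exists (G0 g); rewrite /shiftop (aG _ dg).1 -gf /shiftop.
  have [lG0 _ _ _] := hG.
  by rewrite addrC -lG0// addrC.
have a0 := onto_shiftop_nonneg la rsa a_onto.
split; [exact: symmetric_bounded|exact/self_adjoint_totalP|] => x x0.
rewrite (symmetric_inner_real _ sa) -[0]/(real_complex R 0) ltcR lt_def a0 andbT.
apply: contraNN x0 => /eqP ax0.
(* For nonnegative [a], a zero of the quadratic form is a zero of [a], because
   [rnorm (a x) ^+ 2 <= N * rinner (a x) x]. Undoing the two involutions then gives [x = 0]. *)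
have [N N0 aN] := hellinger_toeplitz rsa.
have := nonneg_norm_le la rsa a0 N0 aN x.
rewrite ax0 mulr0 exprn_even_le0//= => /eqP/rnorm_eq0 ax.
rewrite -(cc alpha x) -(cc alphaJ (cC alpha x)) -/(a x) ax.
by rewrite (linear_map0 lcJ) (linear_map0 lc).
Qed.
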